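(* Let $G_1=(V_1,E_1)$ be a graph with $G_1=EI(\mathcal{H}_1)$ for some 3-uniform hypergraph $\mathcal{H}_1=(V_1,\mathcal{E}_1)$, let $v\in V_1$ with $d_{G_1}(v)\ge 1$, and let $C_n=(V_2,E_2)$ be a cycle of length $n\ge 3$ with $V_1\cap V_2=\{v\}$. Suppose moreover that if $n=4$ then $|V_1|\ge 5$. Then the 1-fusion $G_1\oplus C_n=(V_1\cup V_2,\,E_1\cup E_2)$ is the edge intersection hypergraph of some 3-uniform hypergraph.
   Context: All graphs and hypergraphs are finite, may have isolated vertices, and have no loops or multiple edges. A hypergraph is 3-uniform if every hyperedge has exactly 3 vertices. The edge intersection hypergraph of $\mathcal{H}=(V,\mathcal{E})$ is $EI(\mathcal{H})=(V,\mathcal{E}^{EI})$ with $\mathcal{E}^{EI}=\{e_1\cap e_2 : e_1,e_2\in\mathcal{E},\ e_1\neq e_2,\ |e_1\cap e_2|\ge 2\}$; it has the same vertex set as $\mathcal{H}$, and when it is 2-uniform it is regarded as a simple graph; ''$G=EI(\mathcal{H})$'' means equality of vertex sets and edge sets. For two graphs sharing exactly one vertex, their 1-fusion is simply their union (vertex sets and edge sets united). $d_{G_1}(v)$ denotes the degree of $v$ in $G_1$. *)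

(* Defs.v *)
From HB Require Import structures.
From mathcomp Require Import all_boot.

Set Implicit Arguments.
Unset Strict Implicit.
Unset Printing Implicit Defensive.

Definition hypergraph_axiom (T : finType) (V : {set T}) (E : {set {set T}}) :=
  [forall e in E, (e \subset V) && (1 < #|e|)].

(* The vertex set is an arbitrary subset of the ambient type, so that graphs
   with different, possibly overlapping, vertex sets can be united.  Since the
   axiom is boolean, equality of hypergraphs amounts to equality of the vertex
   sets and of the edge sets (lemma hypergraph_eqP). *)
Record hypergraph (T : finType) := Hypergraph {
  vertices : {set T};
  edges : {set {set T}};
  _ : hypergraph_axiom vertices edges }.

Lemma hypergraph_eqP (T : finType) (G H : hypergraph T) :
  G = H <-> vertices G = vertices H /\ edges G = edges H.
Proof.
split=> [-> // | []]; case: G H => [V E ax] [V' E' ax'] /= eV eE.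
by subst; rewrite (bool_irrelevance ax ax').
Qed.

Definition uniform (T : finType) (k : nat) (H : hypergraph T) :=
  [forall e in edges H, #|e| == k].

Definition is_graph (T : finType) (G : hypergraph T) := uniform 2 G.

Definition degree (T : finType) (G : hypergraph T) (v : T) :=
  #|[set e in edges G | v \in e]|.

Definition EI_edges (T : finType) (H : hypergraph T) : {set {set T}} :=
  [set e1 :&: e2 | e1 in edges H, e2 in edges H &
     (e1 != e2) && (1 < #|e1 :&: e2|)].

Lemma EI_subproof (T : finType) (H : hypergraph T) :
  hypergraph_axiom (vertices H) (EI_edges H).
Proof.
apply/forall_inP=> e /imset2P[e1 e2 He1]; rewrite inE => /and3P[_ _ H12] ->.
rewrite H12 andbT; case: H He1 => V E /= /forall_inP ax /ax /andP[s _].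
exact: subset_trans (subsetIl _ _) s.
Qed.

Definition EI (T : finType) (H : hypergraph T) : hypergraph T :=
  Hypergraph (EI_subproof H).

Lemma hunion_subproof (T : finType) (G H : hypergraph T) :
  hypergraph_axiom (vertices G :|: vertices H) (edges G :|: edges H).
Proof.
case: G H => [V E /forall_inP ax] [V' E' /forall_inP ax'] /=.
apply/forall_inP=> e /setUP[/ax|/ax'] /andP[s ->]; rewrite andbT.
  exact: subset_trans s (subsetUl _ _).
exact: subset_trans s (subsetUr _ _).
Qed.

(* When the vertex sets share exactly one vertex, this is the 1-fusion. *)
Definition hunion (T : finType) (G H : hypergraph T) : hypergraph T :=
  Hypergraph (hunion_subproof G H).

(* [next c x] is the cyclic successor of x in the duplicate-free sequence c.
   This is the cycle of length n as a simple graph only when 3 <= n. *)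
Definition is_cycle (T : finType) (n : nat) (C : hypergraph T) :=
  exists c : seq T,
    [/\ uniq c, size c = n, vertices C = [set x in c]
      & edges C = [set [set x; next c x] | x in c]].

(* Main.v *)
Require Import Defs.
From HB Require Import structures.
From mathcomp Require Import all_boot.

(* In a 3-uniform hypergraph two distinct hyperedges share at most two
   vertices, so the edges of EI(H) are exactly the pairs contained in at least
   two hyperedges.

   For n >= 5 the cycle is itself the EI of its triples of consecutive vertices,
   and the union of the two hypergraphs works because a hyperedge of the one
   meets a hyperedge of the other in at most v.  For n = 3, 4 pick
   hyperedges vwx, vwy of H1, which exist since v has a neighbour w.
   - Cycle v a b: add vab, vwa, vwb, xab.
   - Cycle v a b c: add vab, abc, ybc, vwa, vwc, vxc.  The only unwanted pair is
     vx, now contained in both vwx and vxc.  If no hyperedge of H1 other than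
     vwx contains vx, replace vwx by wxb, which supports the pair wx as vwx did
     while vw is supported by vwa and vwc. *)

Set Implicit Arguments.
Unset Strict Implicit.
Unset Printing Implicit Defensive.

(** * Codegrees of pairs and the edges of [EI] *)

Section Codegree.
Variable T : finType.
Implicit Types (E : {set {set T}}) (G H : hypergraph T) (e V : {set T}).

Definition codegree E (p q : T) := #|[set e in E | (p \in e) && (q \in e)]|.

(** Evaluates codegrees in an explicit family one hyperedge at a time; the guard [e \notin E]
    prevents counting a hyperedge twice. *)
Lemma codegreeU1 E e p q :
  codegree (e |: E) p q =
  ((e \notin E) && ((p \in e) && (q \in e))) + codegree E p q.
Proof.
rewrite /codegree setIdE setIUl -!setIdE.
have [eE|eE] /= := boolP (e \in E).
  rewrite (setUidPr _) //; apply/subsetP=> f.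
  by rewrite !inE => /andP[/eqP-> ->]; rewrite eE.
case: (boolP (_ && _)) => pq /=.
  have -> : [set f in [set e] | (p \in f) && (q \in f)] = [set e].
    by apply/setP=> f; rewrite !inE andb_idr // => /eqP->.
  by rewrite cardsU1 inE (negPf eE).
rewrite add0n; congr #|pred_of_set _|; apply/setP=> f; rewrite !inE.
by case: eqP => //= ->; rewrite (negPf pq) (negPf eE).
Qed.

Lemma codegreeD1 E e p q : e \in E ->
  codegree E p q = ((p \in e) && (q \in e)) + codegree (E :\ e) p q.
Proof. by move=> eE; rewrite -{1}(setD1K eE) codegreeU1 !inE eqxx. Qed.

Lemma codegree_eq0 E V p q :
  (forall e, e \in E -> e \subset V) -> (p \notin V) || (q \notin V) ->
  codegree E p q = 0.
Proof.
move=> EV; rewrite -negb_and => /negP pqV; apply/eqP; rewrite cards_eq0.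
apply/eqP/setP=> e; rewrite !inE; apply/negP=> /and3P[/EV/subsetP eV pe qe].
by case: pqV; rewrite !eV.
Qed.

Lemma card_set3 (p q r : T) :
  p != q -> p != r -> q != r -> #|[set p; q; r]| = 3.
Proof.
by move=> pq pr qr; rewrite setUC cardsU1 !inE cards2 pq !(eq_sym r) negb_or pr qr.
Qed.

Lemma set3_of_pair e p q : #|e| = 3 -> p != q -> p \in e -> q \in e ->
  exists r, [/\ p != r, q != r & e = [set p; q; r]].
Proof.
move=> e3 pq pe qe.
have /cards1P[r er] : #|e :\ p :\ q| == 1.
  by move: e3; rewrite (cardsD1 p) pe (cardsD1 q) !inE (eq_sym q) pq qe !add1n => -[->].
have : r \in e :\ p :\ q by rewrite er inE.
rewrite !inE ![r == _]eq_sym => /and3P[qr pr re]; exists r; split=> //.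
by rewrite -(setD1K pe) -(setD1K (_ : q \in e :\ p)) ?er ?setUA // !inE (eq_sym q) pq.
Qed.

Lemma eq_set2 (p q r s : T) : p != q ->
  ([set p; q] == [set r; s]) = (p == r) && (q == s) || (p == s) && (q == r).
Proof.
move=> pq; apply/eqP/idP => [/setP eqpq|]; last first.
  by case/orP=> /andP[/eqP-> /eqP->] //; rewrite setUC.
move: (eqpq p) (eqpq q) pq; rewrite !inE !eqxx orbT /=.
by move=> /esym/orP[]/eqP-> /esym/orP[]/eqP->; rewrite !eqxx ?orbT.
Qed.

Lemma mem_EI_codegree H p q : uniform 3 H -> p != q ->
  ([set p; q] \in edges (EI H)) = (1 < codegree (edges H) p q).
Proof.
move=> /forall_inP H3 pq; apply/imset2P/card_gt1P => [[e f He] | [e [f]]].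
  rewrite inE => /and3P[Hf ef _] /setP pqef; exists e, f.
  move: (pqef p) (pqef q); rewrite !inE !eqxx orbT.
  by move=> /esym/andP[-> ->] /esym/andP[-> ->]; rewrite He Hf.
rewrite !inE => -[/and3P[He pe qe] /and3P[Hf pf qf] ef].
have [r [pr qr er]] := set3_of_pair (eqP (H3 _ He)) pq pe qe.
have [s [ps qs fs]] := set3_of_pair (eqP (H3 _ Hf)) pq pf qf.
have rs : r != s by apply: contraNneq ef => rs; rewrite er fs rs.
have -> : [set p; q] = e :&: f.
  apply/setP=> z; rewrite er fs !inE; case: eqP => //= _; case: eqP => //= _.
  by apply/esym/negP=> /andP[/eqP->]; rewrite (negPf rs).
exists e f => //; rewrite inE Hf ef; apply/card_gt1P; exists p, q.
by rewrite !inE pe pf qe qf.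
Qed.

(** The intersection of two distinct triples is a proper subset of the first, hence has at most two
    vertices, and [EI] keeps only those with at least two. *)
Lemma uniform_EI H : uniform 3 H -> is_graph (EI H).
Proof.
move=> /forall_inP H3; apply/forall_inP=> f /imset2P[e1 e2 H1].
rewrite inE => /and3P[H2 e12 gt1] ->; rewrite eqn_leq gt1 andbT.
have /eqP c1 := H3 _ H1; have /eqP c2 := H3 _ H2.
rewrite -ltnS -c1 proper_card // properEneq subsetIl andbT.
by apply: contraNneq e12 => /setIidPl e12; rewrite eqEcard e12 c1 c2.
Qed.

Lemma eq_graph_edges G G' : is_graph G -> is_graph G' ->
  (forall p q, p != q ->
    ([set p; q] \in edges G) = ([set p; q] \in edges G')) ->
  edges G = edges G'.
Proof.
move=> /forall_inP G2 /forall_inP G2' eqG; apply/setP=> f.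
have [/cards2P[p [q [pq ->]]]|f2] := boolP (#|f| == 2); first exact: eqG.
by rewrite (contraNF (@G2 f) f2) (contraNF (@G2' f) f2).
Qed.

(** The criterion used for every explicit construction below: both sides are 2-uniform, so comparing
    them on pairs suffices, and there codegrees decide. *)
Lemma graph_EI_ex G E : is_graph G ->
  (forall e, e \in E -> e \subset vertices G /\ #|e| = 3) ->
  (forall p q, p != q -> ([set p; q] \in edges G) = (1 < codegree E p q)) ->
  exists H, uniform 3 H /\ G = EI H.
Proof.
move=> G2 EV GE.
have ax : hypergraph_axiom (vertices G) E.
  by apply/forall_inP=> e /EV[-> ->].
have H3 : uniform 3 (Hypergraph ax) by apply/forall_inP=> e /EV[_ ->].
exists (Hypergraph ax); split=> //; apply/hypergraph_eqP; split=> //.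
apply: eq_graph_edges (uniform_EI H3) _ => // p q pq.
by rewrite mem_EI_codegree // GE.
Qed.

Lemma EI_hunion H1 H2 : #|vertices H1 :&: vertices H2| <= 1 ->
  hunion (EI H1) (EI H2) = EI (hunion H1 H2).
Proof.
case: H1 H2 => [V1 E1 ax1] [V2 E2 ax2] /= V12.
have sub V E (ax : hypergraph_axiom V E) e : e \in E -> e \subset V.
  by move/(forall_inP ax)/andP=> [].
have cross e f : e \in E1 -> f \in E2 -> #|e :&: f| <= 1.
  move=> /(sub _ _ ax1) e1 /(sub _ _ ax2) f2.
  exact: leq_trans (subset_leq_card (setISS e1 f2)) V12.
apply/hypergraph_eqP; split=> //=; apply/setP=> f.
apply/setUP/imset2P => [[]/imset2P[e1 e2] /= h1|[e1 e2] /=].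
- rewrite inE => /andP[h2 h12] ->; exists e1 e2; rewrite ?inE ?h1 //.
  by rewrite h2.
- rewrite inE => /andP[h2 h12] ->; exists e1 e2; rewrite ?inE ?h1 ?orbT //.
  by rewrite h2 orbT.
rewrite !inE => /orP[]h1 /and3P[/orP[]h2 ne gt1] ->.
- by left; apply/imset2P; exists e1 e2; rewrite // inE h2 ne.
- by move: gt1; rewrite ltnNge cross.
- by move: gt1; rewrite setIC ltnNge cross.
- by right; apply/imset2P; exists e1 e2; rewrite // inE h2 ne.
Qed.

End Codegree.

(** * Cycles, and those of length at least 5 *)

Section Cycles.
Variable T : finType.
Implicit Types (c : seq T) (C G H : hypergraph T).

(** The vertices of [c] form a single orbit of [next c], of order [size c], so fewer steps cannot
    lead back to [x]. *)
Lemma iter_next_neq c x k : uniq c -> x \in c -> 0 < k < size c ->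
  iter k (next c) x != x.
Proof.
move=> Uc xc /andP[k0 kc]; apply/eqP=> xk.
have := findex_iter (_ : k < order (next c) x).
rewrite (order_cycle (cycle_next Uc) Uc xc) => /(_ kc).
by rewrite xk findex0 => k_eq0; rewrite -k_eq0 in k0.
Qed.

(** No pair [[set x; next c x]] collapses to a singleton, because the hypergraph axiom demands more
    than one vertex in each edge. *)
Lemma is_cycle_graph n C : is_cycle n C -> is_graph C.
Proof.
case: C => V E ax [c [_ _ _ /= defE]]; apply/forall_inP => /= e eE.
have /andP[_] := forall_inP ax e eE; move: eE; rewrite defE.
by case/imsetP=> x _ ->; rewrite cards2; case: eqP.
Qed.

Lemma is_cycle_from n C v : is_cycle n C -> v \in vertices C ->
  exists s, [/\ uniq (v :: s), size s = n.-1, vertices C = [set x in v :: s]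
    & edges C = [set [set x; next (v :: s) x] | x in v :: s]].
Proof.
move=> [c [Uc <- VC EC]]; rewrite {1}VC inE => vc.
have [i s rot_c] := rot_to vc; exists s; rewrite -rot_c rot_uniq.
split=> //; first by rewrite -(size_rot i c) rot_c.
  by rewrite VC; apply/setP=> x; rewrite !inE mem_rot.
rewrite EC; apply/setP=> e.
by apply/imsetP/imsetP => -[x xc ->]; exists x; rewrite ?next_rot //;
  rewrite mem_rot in xc *.
Qed.

Lemma long_cycle_EI n C : is_cycle n C -> 5 <= n ->
  exists H, uniform 3 H /\ C = EI H.
Proof.
move=> Cn n5; have C2 := is_cycle_graph Cn; have [c [Uc size_c VC EC]] := Cn.
set f := next c in EC.
have fc x : (f x \in c) = (x \in c) by exact: mem_next.
(* The bound 5 enters here: one and two steps make [e x] a triple, three separate consecutive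
   triples, four serve in the last case of the proof. *)
have fN x k : x \in c -> 0 < k < 5 -> iter k f x != x.
  move=> xc /andP[k0 k5]; apply: iter_next_neq => //.
  by rewrite k0 size_c (leq_trans k5).
pose e x := [set x; f x; f (f x)].
apply: (@graph_EI_ex _ _ [set e x | x in c]) => // [_ /imsetP[x xc ->]|p q pq].
  split; first by rewrite VC !subUset !sub1set !inE !fc xc.
  by rewrite card_set3 // eq_sym ?(fN x 1) ?(fN x 2) ?(fN (f x) 1) ?fc.
rewrite EC; apply/imsetP/card_gt1P => [[x xc pqx]|[e1 [e2 []]]].
  (* The edge from [x] to [f x] lies in the triples starting at [x] and at its predecessor [z]; only
     the former contains [f (f x)]. *)
  pose z := prev c x; have fz : f z = x by exact: next_prev.
  have zc : z \in c by rewrite mem_prev.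
  have inP (r : T) : r \in [set p; q] -> (r \in e z) * (r \in e x).
    by rewrite pqx !inE fz => /orP[]/eqP->; rewrite !eqxx ?orbT.
  exists (e z), (e x).
  have [[pz px] [qz qx]] := (inP p (set21 p q), inP q (set22 p q)).
  split; first by rewrite in_set imset_f //= pz qz.
    by rewrite in_set imset_f //= px qx.
  apply/eqP => /setP/(_ (f (f x))); rewrite !inE eqxx orbT -fz.
  by rewrite (negPf (fN z 3 _ _)) ?(negPf (fN (f z) 2 _ _))
     ?(negPf (fN (f (f z)) 1 _ _)) ?fc.
(* A pair inside a triple is a cycle edge or the pair of its two ends. *)
have pair x : x \in c -> p \in e x -> q \in e x ->
    (exists2 y, y \in c & [set p; q] = [set y; f y])
    \/ [set p; q] = [set x; f (f x)].
  move=> xc; rewrite !inE => px qx; move: px qx pq.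
  move=> /orP[/orP[]|] /eqP-> /orP[/orP[]|] /eqP->; rewrite ?eqxx // => _;
    solve [by left; exists x | by left; exists (f x); rewrite ?fc
         | by left; exists x; rewrite // setUC
         | by left; exists (f x); rewrite ?fc // setUC
         | by right | by right; rewrite setUC].
rewrite !inE => /andP[/imsetP[x xc e1x] /andP[px qx]].
move=> /andP[/imsetP[y yc e2y] /andP[py qy]] e12.
rewrite {}e1x {}e2y in px qx py qy e12.
(* What remains is a common pair of ends of both triples: then [x = y], or each start is two steps
   after the other and four steps fix [y]. *)
have [//|pqx] := pair x xc px qx; have [//|/eqP] := pair y yc py qy.
rewrite pqx eq_set2 => [|]; last by rewrite eq_sym (fN x 2).
case/orP=> /andP[/eqP xy' /eqP yx].
  by rewrite xy' eqxx in e12.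
by have := fN y 4 yc isT; rewrite /= -xy' yx eqxx.
Qed.

End Cycles.

(** * Fusion with a triangle or a 4-cycle *)

Section ShortCycles.
Variable T : finType.
Implicit Types (C G H : hypergraph T).

Lemma uniform3P H e : uniform 3 H -> e \in edges H ->
  e \subset vertices H /\ #|e| = 3.
Proof.
case: H => V E ax /= /forall_inP E3 eE; split; last exact/eqP/E3.
by have /andP[] := forall_inP ax e eE.
Qed.

Lemma codegreeC (E : {set {set T}}) p q : codegree E p q = codegree E q p.
Proof. by apply: eq_card => e; rewrite !inE [(p \in e) && _]andbC. Qed.

Lemma mem_imset_seq (F : T -> {set T}) (s : seq T) e :
  (e \in [set F x | x in s]) = has (fun x => e == F x) s.
Proof.
apply/imsetP/hasP => [[x xs ->]|[x xs /eqP->]]; first by exists x.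
by exists x.
Qed.

(** One conjunct for each position of the new vertex [r], so that rewriting discards any explicit
    triple through [r]. *)
Lemma notin_set3 (E : {set {set T}}) (V : {set T}) r :
  (forall e, e \in E -> e \subset V) -> r \notin V ->
  (forall p q, ([set r; p; q] \in E) = false) *
  (forall p q, ([set p; r; q] \in E) = false) *
  (forall p q, ([set p; q; r] \in E) = false).
Proof.
move=> EV rV.
have notE (e : {set T}) : r \in e -> (e \in E) = false.
  by move=> re; apply: contraNF rV => /EV/subsetP->.
by split=> [|p q]; [split=> p q|]; apply: notE; rewrite !inE eqxx ?orbT.
Qed.

Lemma is_graph_hunion G C : is_graph G -> is_graph C -> is_graph (hunion G C).
Proof.
move=> /forall_inP G2 /forall_inP C2; apply/forall_inP=> e.
by rewrite inE => /orP[/G2|/C2].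
Qed.

Lemma codegree_notin (E : {set {set T}}) (V : {set T}) r :
  (forall e, e \in E -> e \subset V) -> r \notin V ->
  (forall q, codegree E r q = 0) * (forall q, codegree E q r = 0).
Proof.
by move=> EV rV; split=> q; apply: (codegree_eq0 EV); rewrite rV ?orbT.
Qed.

Ltac neq_simpl := repeat match goal with
  | ne : is_true (?a != ?b) |- context [?a == ?b] => rewrite (negPf ne)
  | ne : is_true (?a != ?b) |- context [?b == ?a] =>
      rewrite (eq_sym b a) (negPf ne)
  end; rewrite ?eqxx ?andbF ?orbT ?orbF /=.

(* Splits on every test [p == r] left in the goal; the distinctness facts in
   the context then evaluate all other equality tests. *)
Ltac split_vertices := neq_simpl; repeat (match goal with
  |- context [?p == ?r] => have [?|?] := eqVneq p r; [subst p|]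
  end; neq_simpl).

(** Each of va, vb, ab lies in two added triples, and every other pair meeting {a, b} in at most
    one. Inside [H] only vw gains, and it is already an edge. *)
Lemma triangle_fusion H C v w x a b :
  uniform 3 H -> is_graph C -> uniq [:: v; w; x; a; b] ->
  [&& v \in vertices H, w \in vertices H & x \in vertices H] ->
  (a \notin vertices H) && (b \notin vertices H) ->
  [set v; w] \in edges (EI H) ->
  vertices C = [set z in [:: v; a; b]] ->
  edges C = [set [set z; next [:: v; a; b] z] | z in [:: v; a; b]] ->
  exists H', uniform 3 H' /\ hunion (EI H) C = EI H'.
Proof.
move=> H3 C2 /= + /and3P[vV wV xV] /andP[aV bV] vwE VC EC.
rewrite !inE !negb_or -!andbA.
do !case/andP => ?; move=> _.
have subV e : e \in edges H -> e \subset vertices H.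
  by case/(uniform3P H3).
(* The successor form lets the final comparison with 1 compute. *)
have [k cvw] : exists k, codegree (edges H) v w = k.+2.
  move: vwE; rewrite mem_EI_codegree //; case: codegree => [|[|k]] // _.
  by exists k.
pose E := [set v; a; b] |: ([set v; w; a] |: ([set v; w; b]
  |: ([set x; a; b] |: edges H))).
have EV e : e \in E -> e \subset vertices (hunion (EI H) C) /\ #|e| = 3.
  rewrite !in_setU1.
  case/predU1P=> [->|/predU1P[->|/predU1P[->|/predU1P[->|]]]].
  5: by move=> /(uniform3P H3)[eV ->]; split; rewrite // subsetU ?eV.
  1-4: split; last by rewrite card_set3.
  1-4: by rewrite !subUset !sub1set !inE VC !inE ?vV ?wV ?xV ?eqxx ?orbT.
apply: (graph_EI_ex (is_graph_hunion (uniform_EI H3) C2) EV) => p q pq.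
rewrite in_setU mem_EI_codegree // EC mem_imset_seq /=.
rewrite !eq_set2 // !codegreeU1 !in_setU1.
rewrite !(notin_set3 subV aV) !(notin_set3 subV bV).
(* Equality of added triples becomes vertex membership, so everything depends only on which named
   vertices [p] and [q] are. *)
rewrite !eqEsubset !subUset !sub1set !inE; split_vertices.
all: by rewrite ?(codegree_notin subV aV, codegree_notin subV bV)
  ?(codegreeC _ w v) ?cvw.
Qed.

(** Each of va, ab, bc, cv lies in two added triples, and every other pair meeting {a, b, c} in at
    most one. Inside [H] the added triples can affect only vw, already an edge, and vx. *)
Lemma square_fusion H C v w x y a b c :
  uniform 3 H -> is_graph C -> uniq [:: v; w; x; y; a; b; c] ->
  ([set v; w; x] \in edges H) && ([set v; w; y] \in edges H) ->
  [&& a \notin vertices H, b \notin vertices H & c \notin vertices H] ->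
  vertices C = [set z in [:: v; a; b; c]] ->
  edges C = [set [set z; next [:: v; a; b; c] z] | z in [:: v; a; b; c]] ->
  exists H', uniform 3 H' /\ hunion (EI H) C = EI H'.
Proof.
move=> H3 C2 /= + /andP[vwxE vwyE] /and3P[aV bV cV] VC EC.
rewrite !inE !negb_or -!andbA.
do !case/andP => ?; move=> _.
have subV e : e \in edges H -> e \subset vertices H.
  by case/(uniform3P H3).
have := subV _ vwyE; have := subV _ vwxE.
rewrite !subUset !sub1set -!andbA => /and3P[vV wV xV] /and3P[_ _ yV].
(* Both variants of the construction contain [F], so all codegrees are reduced to those of [F]. *)
pose F := edges H :\ [set v; w; x].
have subF e : e \in F -> e \subset vertices H by case/setD1P => _ /subV.
have cD p q : codegree (edges H) p q =
    ((p \in [set v; w; x]) && (q \in [set v; w; x])) + codegree F p q.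
  exact: codegreeD1.
have [k cvw] : exists k, codegree F v w = k.+1.
  have vwyF : [set v; w; y] \in F.
    by rewrite !inE vwyE eqEsubset !subUset !sub1set !inE; neq_simpl.
  by rewrite (codegreeD1 v w vwyF) !inE !eqxx orbT; eexists.
(* Since vwx contains vx, the test asks whether vx is already an edge of [EI H]; if so, adding vxc
   does no harm. *)
pose E := [set v; a; b] |: ([set a; b; c] |: ([set y; b; c]
  |: ([set v; w; a] |: ([set v; w; c] |: ([set v; x; c] |:
     (if 0 < codegree F v x then edges H else [set w; x; b] |: F)))))).
have EV e : e \in E -> e \subset vertices (hunion (EI H) C) /\ #|e| = 3.
  rewrite !in_setU1.
  case/predU1P=> [->|/predU1P[->|/predU1P[->|]]];
    last case/predU1P=> [->|/predU1P[->|/predU1P[->|]]].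
  7: have HV f : f \in edges H ->
      f \subset vertices (hunion (EI H) C) /\ #|f| = 3.
  7: by move=> /(uniform3P H3)[fV ->]; split; rewrite // subsetU ?fV.
  7: by case: ifP => _ => [/HV//|/setU1P[->|/setD1P[_ /HV]//]]; split;
    rewrite ?card_set3 // !subUset !sub1set !inE VC !inE ?wV ?xV ?eqxx ?orbT.
  1-6: split; last by rewrite card_set3.
  1-6: by rewrite !subUset !sub1set !inE VC !inE ?vV ?wV ?xV ?yV ?eqxx ?orbT.
apply: (graph_EI_ex (is_graph_hunion (uniform_EI H3) C2) EV) => p q pq.
rewrite in_setU mem_EI_codegree // EC mem_imset_seq /= !eq_set2 // /E {EV E}.
case: (posnP (codegree F v x)) => [cvx|/prednK/esym].
{ rewrite !codegreeU1 !in_setU1 cD.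
  rewrite !(notin_set3 subF aV) !(notin_set3 subF bV) !(notin_set3 subF cV).
  rewrite !eqEsubset !subUset !sub1set !inE; split_vertices.
  all: by rewrite ?(codegree_notin subF aV, codegree_notin subF bV,
    codegree_notin subF cV) ?(codegreeC _ w v, codegreeC _ x v) ?cvw ?cvx. }
move: (codegree F v x).-1 => m cvx; rewrite !codegreeU1 !in_setU1.
rewrite !(notin_set3 subV aV) !(notin_set3 subV bV) !(notin_set3 subV cV).
rewrite !cD !eqEsubset !subUset !sub1set !inE; split_vertices.
all: by rewrite ?(codegree_notin subF aV, codegree_notin subF bV,
  codegree_notin subF cV) ?(codegreeC _ w v, codegreeC _ x v) ?cvw ?cvx.
Qed.

End ShortCycles.

(** * Choice of the construction by the length of the cycle *)

Theorem theorem5 (T : finType) (G1 C : hypergraph T) (v : T) (n : nat)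
    (G1_graph : is_graph G1)
    (G1_EI : exists H1 : hypergraph T, uniform 3 H1 /\ G1 = EI H1)
    (v_in_G1 : v \in vertices G1)
    (deg_v : 1 <= degree G1 v)
    (n_ge3 : 3 <= n)
    (C_cycle : is_cycle n C)
    (share_v : vertices G1 :&: vertices C = [set v])
    (n4 : n = 4 -> 5 <= #|vertices G1|) :
  exists H : hypergraph T, uniform 3 H /\ hunion G1 C = EI H.
Proof.
have [H [H3 defG1]] := G1_EI; subst G1.
have C2 := is_cycle_graph C_cycle.
have [n5|n_lt5] := leqP 5 n.
  have [K [K3 defC]] := long_cycle_EI C_cycle n5; subst C.
  exists (hunion H K); split; last by rewrite EI_hunion // share_v cards1.
  by move: H3 K3 => /forall_inP H3 /forall_inP K3; apply/forall_inP=> e /setUP[/H3|/K3].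
have vC : v \in vertices C by have := set11 v; rewrite -share_v inE => /andP[].
have [s [Us size_s VC EC]] := is_cycle_from C_cycle vC.
have [w [vw vwE]] : exists w, v != w /\ [set v; w] \in edges (EI H).
  have /card_gt0P[f] := deg_v; rewrite inE => /andP[fE vf].
  have /cards2P[p [q [pq deff]]] := forall_inP G1_graph f fE.
  move: vf fE; rewrite deff !inE => /orP[]/eqP->; first by exists q.
  by exists p; rewrite setUC eq_sym.
have : 1 < codegree (edges H) v w by rewrite -mem_EI_codegree.
case/card_gt1P=> e1 [e2 []]; rewrite !inE => /and3P[e1E ve1 we1].
move=> /and3P[e2E ve2 we2] e12.
have [_ c1] := uniform3P H3 e1E; have [_ c2] := uniform3P H3 e2E.
have [x [vx wx def1]] := set3_of_pair c1 vw ve1 we1.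
have [y [vy wy def2]] := set3_of_pair c2 vw ve2 we2.
have xy : x != y by apply: contraNneq e12 => xy; rewrite def1 def2 xy.
have subV e : e \in edges H -> e \subset vertices H.
  by case/(uniform3P H3).
have := subV _ e2E; have := subV _ e1E; rewrite def1 def2.
rewrite !subUset !sub1set -!andbA => /and3P[vV wV xV] /and3P[_ _ yV].
(* The two vertex sets meet only in [v], which does not recur in [s]. *)
have sV z : z \in s -> z \notin vertices H.
  move=> zs; apply/negP=> zV; have : z \in [set v].
    by rewrite -share_v VC !inE zV zs orbT.
  by rewrite inE => /eqP zv; move: Us; rewrite /= -zv zs.
have neqV t z : t \in vertices H -> z \notin vertices H -> t != z.
  by move=> tV; apply: contraNneq => <-.
(* Only lengths 3 and 4 remain; [s] lists the [n.-1] cycle vertices other than [v]. *)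
case: n n_ge3 n_lt5 size_s {n4 C_cycle} => [|[|[|[|[|n]]]]] // _ _.
  case: s Us VC EC sV => [|a [|b []]] //= /and3P[_ ab _] VC EC sV _.
  have aV := sV a (mem_head _ _).
  have bV : b \notin vertices H by rewrite sV // !inE eqxx orbT.
  apply: (triangle_fusion (x := x) H3 C2 _ _ _ vwE VC EC).
  - rewrite /= !inE !negb_or vw vx wx !(neqV v) // !(neqV w) // !(neqV x) //=.
    by rewrite inE in ab; rewrite ab.
  - by rewrite vV wV xV.
  - by rewrite aV bV.
case: s Us VC EC sV => [|a [|b [|c []]]] //= /and3P[_ abc bc] VC EC sV _.
have aV := sV a (mem_head _ _).
have bV : b \notin vertices H by rewrite sV // !inE eqxx orbT.
have cV : c \notin vertices H by rewrite sV // !inE eqxx !orbT.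
apply: (square_fusion (w := w) (x := x) (y := y) H3 C2 _ _ _ VC EC).
- rewrite /= !inE !negb_or vw vx vy wx wy xy !(neqV v) // !(neqV w) //.
  rewrite !(neqV x) // !(neqV y) //=.
  by move: abc bc; rewrite !inE !negb_or !andbT => /andP[-> ->] ->.
- by rewrite -def1 -def2 e1E e2E.
- by rewrite aV bV cV.
Qed.
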